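(* Consider the event-triggered distributed estimator and the centralized estimator described in the context, and suppose: (i) the communication graph is connected, i.e. $\lambda_2(\mathcal{L})>0$; (ii) $G=\sum_{i=1}^N H_i^TH_i$ is full rank; (iii) there is $\epsilon_1>0$ with $\mathbb{E}\{\|V(t)\|^{2+\epsilon_1}\}<\infty$; (iv) the step sizes are $\alpha(t)=\frac{a}{(t+1)^{\tau_1}}$ and $\beta(t)=\frac{b}{(t+1)^{\tau_2}}$ with $a,b>0$, $0<\tau_2\le\tau_1\le 1$, and $\tau_1>\max\{\tau_2+\frac{1}{2+\epsilon_1},0.5\}$; (v) the centralized estimator uses $\alpha_c(t)=\frac{a_c}{(t+1)^{\tau_c}}$ with $\tau_c=\tau_1$ and $a_c=a$. Let $\rho_0=\min_{j\in\mathcal{V}}\rho_j$ and suppose $\rho_0>\tau_1-\tau_2$. Let $\tau_0$ satisfy $0\le\tau_0<\min\{\tau_1-\tau_2-\frac{1}{2+\epsilon_1},\ \rho_0+\tau_2-\tau_1\}$, and if $\tau_1=1$ assume in addition $a>\frac{N\tau_0}{\lambda_{\min}(G)}$. Then for every $i\in\mathcal{V}$, $\mathbb{P}\big(\lim_{t\to\infty}(t+1)^{\tau_0}\|x_i(t)-u(t)\|=0\big)=1$.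
   Context: An unknown parameter $\theta\in\mathbb{R}^n$ is observed by $N$ agents $\mathcal{V}=\{1,\dots,N\}$ via $y_i(t)=H_i\theta+v_i(t)$, $t=0,1,2,\dots$, where $H_i\in\mathbb{R}^{m_i\times n}$ is known and the noise $v_i(t)\in\mathbb{R}^{m_i}$ is zero mean with covariance $R_i$. The stacked noise $V(t)=[v_1(t)^T,\dots,v_N(t)^T]^T$ is i.i.d. over time (noises of different agents at the same time may be correlated). Agents communicate over an undirected graph without self-loops with adjacency matrix $\mathcal{A}=[a_{ij}]\in\{0,1\}^{N\times N}$, neighbor sets $\mathcal{N}_i=\{j: a_{ij}=1\}$, degree matrix $\mathcal{D}$ and Laplacian $\mathcal{L}=\mathcal{D}-\mathcal{A}$. Each agent $i$ has a threshold exponent $\rho_i>0$. Agent $i$ keeps an estimate $x_i(t)\in\mathbb{R}^n$ (arbitrary deterministic initial value $x_i(0)$, which is the first transmitted value). Let $t_k^i$ be the latest triggering (transmission) time of agent $i$. At time $t$, agent $i$ triggers (broadcasts $x_i(t)$ to its neighbors, which then becomes its latest transmitted value) iff $\|x_i(t)-x_i(t_k^i)\|>\frac{1}{(t+1)^{\rho_i}}$. Denoting by $x_j(t_k^j)$ the latest value transmitted by agent $j$ up to and including time $t$, the distributed estimator is $x_i(t+1)=x_i(t)+\alpha(t)H_i^T\big(y_i(t)-H_ix_i(t)\big)+\beta(t)\sum_{j\in\mathcal{N}_i}\big(x_j(t_k^j)-x_i(t)\big)$. The centralized linear estimator uses the same measurements: $u(t+1)=u(t)+\frac{\alpha_c(t)}{N}\sum_{i=1}^N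 H_i^T\big(y_i(t)-H_iu(t)\big)$ with arbitrary deterministic initial value $u(0)$. *)

(* Defs.v *)
From HB Require Import structures.
From mathcomp Require Import all_boot all_order all_algebra.
From mathcomp Require Import all_classical all_reals all_analysis.
Set Implicit Arguments. Unset Strict Implicit. Unset Printing Implicit Defensive.
Import Order.TTheory GRing.Theory Num.Theory.
Import numFieldNormedType.Exports.
Local Open Scope classical_set_scope.
Local Open Scope ring_scope.

Section Defs.
Variable R : realType.

Definition enorm k (x : 'cV[R]_k) : R := Num.sqrt (\sum_(j < k) x j 0 ^+ 2).

Definition stack_norm N (m : 'I_N -> nat) (v : forall i : 'I_N, 'cV[R]_(m i)) : R :=
  Num.sqrt (\sum_(i < N) \sum_(k < m i) v i k 0 ^+ 2).

Definition is_min_eigenvalue n (G : 'M[R]_n) (l : R) : Prop :=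
  eigenvalue G l /\ forall l', eigenvalue G l' -> l <= l'.

Definition is_min_of N (rho : 'I_N -> R) (r0 : R) : Prop :=
  (exists j, rho j = r0) /\ forall j, r0 <= rho j.

Definition undirected_simple N (adj : rel 'I_N) : Prop :=
  (forall i j, adj i j = adj j i) /\ forall i, ~~ adj i i.
Definition connected_graph N (adj : rel 'I_N) : Prop :=
  forall i j, connect adj i j.

Definition gram N n (m : 'I_N -> nat) (H : forall i : 'I_N, 'M[R]_(m i, n)) : 'M[R]_n :=
  \sum_(i < N) (H i)^T *m H i.

Section Estimator.
Variables (N n : nat) (m : 'I_N -> nat) (H : forall i : 'I_N, 'M[R]_(m i, n)).
Variable adj : rel 'I_N.
Variables (alpha beta : nat -> R) (rho : 'I_N -> R).
Variable y : forall i : 'I_N, nat -> 'cV[R]_(m i).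
Variable x0 : 'I_N -> 'cV[R]_n.

(* triggering rule at time s: given the current estimate xs and the latest
   transmitted values xh (before time s), return the latest transmitted
   values up to and including time s *)
Definition trigger (s : nat) (xs xh : 'I_N -> 'cV[R]_n) : 'I_N -> 'cV[R]_n :=
  fun i => if enorm (xs i - xh i) > 1 / (s.+1%:R `^ rho i) then xs i else xh i.

Definition est_update (t : nat) (xt xh : 'I_N -> 'cV[R]_n) : 'I_N -> 'cV[R]_n :=
  fun i => xt i + alpha t *: ((H i)^T *m (y i t - H i *m xt i))
           + beta t *: (\sum_(j < N | adj i j) (xh j - xt i)).

(* (x(t), latest transmitted values up to and including time t) *)
Fixpoint est_state (t : nat) : ('I_N -> 'cV[R]_n) * ('I_N -> 'cV[R]_n) :=
  match t with
  | 0 => (x0, x0)   (* x_i(0) is the first transmitted value *)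
  | t'.+1 =>
      let: (xt, xh) := est_state t' in
      let xt' := est_update t' xt xh in
      (xt', trigger t'.+1 xt' xh)
  end.

Definition est_x (t : nat) (i : 'I_N) : 'cV[R]_n := (est_state t).1 i.
End Estimator.

Fixpoint central_u N n (m : 'I_N -> nat) (H : forall i : 'I_N, 'M[R]_(m i, n))
  (alphac : nat -> R) (y : forall i : 'I_N, nat -> 'cV[R]_(m i)) (u0 : 'cV[R]_n)
  (t : nat) : 'cV[R]_n :=
  match t with
  | 0 => u0
  | t'.+1 =>
      let u := central_u H alphac y u0 t' in
      u + (alphac t' / N%:R) *: (\sum_(i < N) (H i)^T *m (y i t' - H i *m u))
  end.

Section Noise.
Context {d : measure_display} {T : measurableType d} (P : probability T R).
Variables (N : nat) (m : 'I_N -> nat).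
Variable v : forall i : 'I_N, nat -> T -> 'cV[R]_(m i).

Definition noise_event (t : nat) (B : forall i : 'I_N, 'I_(m i) -> set R) : set T :=
  [set w | forall i k, B i k (v i t w k 0)].

Definition rect_measurable (B : forall i : 'I_N, 'I_(m i) -> set R) : Prop :=
  forall i k, measurable (B i k).

Definition noise_measurable : Prop :=
  forall i t k, measurable_fun setT (fun w => v i t w k 0).

(* the stacked noise V(0), V(1), ... is mutually independent
   (product rule over every finite family of times, tested on Borel
   rectangles, which form a pi-system generating the Borel sets of the
   stacked noise space) *)
Definition noise_indep : Prop :=
  forall (S : seq nat) (B : nat -> forall i : 'I_N, 'I_(m i) -> set R),
    uniq S -> (forall t, rect_measurable (B t)) ->
    P [set w | forall t, t \in S -> noise_event t (B t) w]
    = (\prod_(t <- S) P (noise_event t (B t)))%E.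

Definition noise_ident_distr : Prop :=
  forall t (B : forall i : 'I_N, 'I_(m i) -> set R),
    rect_measurable B -> P (noise_event t B) = P (noise_event 0 B).

Definition noise_iid : Prop := noise_measurable /\ noise_indep /\ noise_ident_distr.

Definition noise_zero_mean : Prop :=
  forall i t k, (\int[P]_w (v i t w k 0)%:E = 0)%E.

Definition noise_moment (eps : R) : Prop :=
  forall t, (\int[P]_w ((stack_norm (fun i => v i t w)) `^ (2 + eps))%:E < +oo)%E.
End Noise.

End Defs.

(* Main.v *)
(* The noise enters only through its growth: identical distribution, Markov's
   inequality and Borel-Cantelli give |v_i(t)| = O((t+1)^kappa) almost surely for
   every kappa > 1/(2+eps1), and everything else is deterministic.  Fix such a
   path.  Let z be the disagreement x_i - mean(x), d = mean(x) - u and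
   w = u - theta.  Comparison with (t+1)^kappa gives w = O((t+1)^kappa).  Since both
   estimators see the same noise with the same gain, d is driven only by z and by
   the triggering errors, while z is contracted by the graph Laplacian:
     |z|+ <= (1 - c beta)|z| + C alpha (|z| + |d| + (t+1)^kappa) + C beta (t+1)^-rho0,
     |d|+ <= (1 - mu alpha)|d| + C alpha |z| + C beta (t+1)^-rho0,
   where mu is any number below lambda_min(G)/N.  The quasi-stationary sizes are
   (alpha/beta)(t+1)^kappa + (t+1)^-rho0 for |z| and |z| + (beta/alpha)(t+1)^-rho0
   for |d|, both o((t+1)^-tau0). *)
Require Import Defs.
From HB Require Import structures.
From mathcomp Require Import all_boot all_order all_algebra.
From mathcomp Require Import all_classical all_reals all_analysis.
From mathcomp Require Import measurable_realfun ring lra.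
Set Implicit Arguments. Unset Strict Implicit. Unset Printing Implicit Defensive.
Import Order.TTheory GRing.Theory Num.Theory.
Import numFieldNormedType.Exports.
Local Open Scope classical_set_scope.
Local Open Scope ring_scope.

(** * Powers of the time index *)

Section Powers.
Variable R : realType.
Implicit Types (t : nat) (r : R).

Definition pw r t : R := t.+1%:R `^ r.

Lemma pw_gt0 r t : 0 < pw r t.
Proof. exact/powR_gt0/ltr0Sn. Qed.

Lemma pw_ge0 r t : 0 <= pw r t.
Proof. exact/ltW/pw_gt0. Qed.

Lemma pwD r s t : pw (r + s) t = pw r t * pw s t.
Proof. by rewrite /pw powRD// pnatr_eq0 implybT. Qed.

Lemma pwN r t : pw (- r) t = (pw r t)^-1.
Proof. exact: powRN. Qed.

Lemma ler_pw r s t : r <= s -> pw r t <= pw s t.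
Proof. by apply: ler_powR; rewrite ler1n. Qed.

Lemma pw_leS r t : 0 <= r -> pw r t <= pw r t.+1.
Proof. by move=> r0; rewrite /pw ge0_ler_powR ?nnegrE// ler_nat. Qed.

Lemma pw_ge1 r t : 0 <= r -> 1 <= pw r t.
Proof. by move=> r0; rewrite -(powRr0 t.+1%:R); apply: ler_pw. Qed.

Lemma pwE r t : pw r t = expR (r * ln t.+1%:R).
Proof. by rewrite /pw /powR pnatr_eq0. Qed.

Lemma pw_cvg0 r : r < 0 -> pw r t @[t --> \oo] --> (0 : R).
Proof.
move=> r0; apply/cvgrPdist_le => e e0; near=> t.
rewrite sub0r normrN ger0_norm ?pw_ge0//.
have -> : e = (e `^ r^-1) `^ r by rewrite -powRrM mulVf ?lt_eqF// powRr1// ltW.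
rewrite -[r]opprK [leLHS]powRN [leRHS]powRN lef_pV2 ?posrE ?powR_gt0//.
rewrite ge0_ler_powR ?nnegrE ?powR_ge0//; first by rewrite oppr_ge0 ltW.
apply: (@le_trans _ _ t%:R); last by rewrite ler_nat.
near: t; exact: nbhs_infty_ger.
Unshelve. all: by end_near.
Qed.

Lemma pw_near_le r K e : r < 0 -> 0 < e -> \forall t \near \oo, K * pw r t <= e.
Proof.
move=> r0 e0; have : K * pw r t @[t --> \oo] --> K * 0 by apply: cvgMl_tmp; apply: pw_cvg0.
rewrite mulr0 => /cvgr0Pnorm_le => /(_ _ e0); apply: filterS => t.
by apply: le_trans; rewrite ler_norm.
Qed.

(** From [ln (1 + x) <= x] and [expR x >= 1 + x]. It makes [pw (- r)] a supersolution of any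
    contraction stronger than [1 - r / (t+1)]. *)
Lemma pw_decay r t : 0 <= r -> (1 - r * pw (- 1) t) * pw (- r) t <= pw (- r) t.+1.
Proof.
move=> r0; rewrite [pw (- 1) t]powR_inv1// !pwE.
have -> : t.+2%:R = t.+1%:R * (1 + t.+1%:R^-1) :> R.
  by rewrite mulrDr divff ?pnatr_eq0// mulr1 -natr1.
have t0 : 0 < t.+1%:R^-1 :> R by rewrite invr_gt0.
rewrite lnM ?posrE ?addr_gt0// mulrDr expRD mulrC ler_pM2l ?expR_gt0//.
apply: le_trans (expR_ge1Dx _); rewrite lerD2l !mulNr lerN2 ler_wpM2l//.
by apply: le_ln1Dx; rewrite (lt_trans _ t0)// oppr_lt0.
Qed.

(** The same logarithm estimate read backwards from [t+2]; it bounds a sum of powers by a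
    telescoping one. *)
Lemma pw_telescope r t : 0 <= r -> r * pw (- r - 1) t.+1 <= pw (- r) t - pw (- r) t.+1.
Proof.
move=> r0; rewrite pwD [pw (- 1) _]powR_inv1// !pwE.
have -> : t.+1%:R = t.+2%:R * (1 - t.+2%:R^-1) :> R.
  by rewrite mulrBr divff ?pnatr_eq0// mulr1 -[t.+2%:R]natr1 addrK.
have t0 : t.+2%:R^-1 < 1 :> R by rewrite invf_lt1// ltr1n.
rewrite lnM ?posrE ?subr_gt0// mulrDr expRD lerBrDr.
rewrite [leLHS](_ : _ = expR (- r * ln t.+2%:R) * (1 + r * t.+2%:R^-1)); last by ring.
rewrite ler_wpM2l ?expR_ge0//; apply: le_trans (expR_ge1Dx _).
by rewrite lerD2l mulNr -mulrN ler_wpM2l// lerNr le_ln1Dx// ltrN2.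
Qed.

Lemma sum_pw_le r n : 0 < r -> \sum_(0 <= t < n) pw (- r - 1) t <= 1 + r^-1.
Proof.
move=> r0; have ri : 0 < r^-1 by rewrite invr_gt0.
(* The induction must keep the remainder [r^-1 * pw (- r) n]; the first term, equal to 1, is treated
   apart. *)
suff H : \sum_(0 <= t < n.+1) pw (- r - 1) t <= 1 + r^-1 - r^-1 * pw (- r) n.
  case: n H => [_|n]; first by rewrite big_geq// addr_ge0// ltW.
  rewrite big_nat_recr//= => H.
  have := pw_ge0 (- r - 1) n.+1; have : 0 <= r^-1 * pw (- r) n.+1.
    by rewrite mulr_ge0 ?pw_ge0// ltW.
  lra.
elim: n => [|n IH]; first by rewrite big_nat1 /pw !powR1 mulr1 addrK.
rewrite big_nat_recr//=.
have := pw_telescope n (ltW r0); rewrite -(ler_pM2l ri) mulrA mulVf ?gt_eqF// mul1r.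
lra.
Qed.
End Powers.

(** * Comparison of real recursions *)

Section Comparison.
Variable R : realType.
Implicit Types (p q r : nat -> R).

Lemma pw_near_dom (x y K e : R) : x < y -> 0 < e ->
  \forall t \near \oo, K * pw x t <= e * pw y t.
Proof.
move=> xy e0; have xy0 : x - y < 0 by rewrite subr_lt0.
apply: filterS (pw_near_le K xy0 e0) => t.
by rewrite pwD pwN mulrA ler_pdivrMr ?pw_gt0.
Qed.

(** Once [C <= mu * W], the contraction absorbs the drive at level [W * pw kappa], and [pw kappa] is
    nondecreasing, so the bound propagates. *)
Lemma linear_growth (r : nat -> R) (mu C a tau1 kappa : R) :
  0 < mu -> 0 <= C -> 0 < a -> 0 < tau1 -> 0 <= kappa ->
  (\forall t \near \oo, r t.+1 <=
     (1 - mu * (a * pw (- tau1) t)) * r t + C * (a * pw (- tau1) t) * pw kappa t) ->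
  exists2 W, 0 <= W & \forall t \near \oo, r t <= W * pw kappa t.
Proof.
move=> mu0 C0 a0 tau10 kappa0 Hr.
have tau1N : - tau1 < 0 by rewrite oppr_lt0.
have [T0 _ HT] := filterI Hr (pw_near_le (mu * a) tau1N ltr01).
pose W := Num.max (C / mu) (r T0).
have W0 : 0 <= W by rewrite le_max divr_ge0// ltW.
exists W => //; exists T0 => // t /= T0t.
rewrite -(subnKC T0t); elim: (t - T0)%N => [|k IH].
  rewrite addn0 (@le_trans _ _ W) ?le_max ?lexx ?orbT//.
  by rewrite ler_peMr// pw_ge1.
rewrite addnS; set s := (T0 + k)%N in IH *.
have [/= H1 H2] := HT s (leq_addr _ _).
have CW : C <= mu * W.
  by rewrite mulrC -ler_pdivrMr// le_max lexx.
have aa : 0 <= a * pw (- tau1) s by rewrite mulr_ge0 ?pw_ge0// ltW.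
apply: le_trans (_ : W * pw kappa s <= _); last by rewrite ler_wpM2l// pw_leS.
apply: le_trans H1 _; move: H2; rewrite -mulrA.
set al := a * _ in aa * => H2.
have : (1 - mu * al) * r s <= (1 - mu * al) * (W * pw kappa s).
  by rewrite ler_wpM2l// subr_ge0.
have : C * (al * pw kappa s) <= mu * W * (al * pw kappa s).
  by rewrite ler_wpM2r// mulr_ge0// pw_ge0.
by lra.
Qed.

(* With [S = (t+1)^-tau'] for some [tau'] slightly larger than [tau0], the pair of
   bounds [p <= M eps S], [q <= M S] is eventually invariant for every [M >= 1]:
   [eps] is chosen so that [p] perturbs the contraction of [q] by less than the
   available gap, and [alpha = o(beta)] absorbs the influence of [q] on [p]. *)
Lemma coupled_decay p q (a b c C mu tau0 tau1 tau2 kappa rho : R) :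
  (forall t, 0 <= p t) -> (forall t, 0 <= q t) ->
  0 < a -> 0 < b -> 0 < c -> 0 <= C -> 0 < mu ->
  0 <= tau0 -> tau1 <= 1 -> 0 < tau2 -> tau2 < tau1 ->
  tau0 + kappa < tau1 - tau2 -> tau0 < rho + tau2 - tau1 ->
  (tau1 = 1 -> tau0 < a * mu) ->
  let alpha t := a * pw (- tau1) t in
  let beta t := b * pw (- tau2) t in
  (\forall t \near \oo, p t.+1 <= (1 - c * beta t) * p t
     + C * alpha t * (p t + q t) + C * alpha t * pw kappa t
     + C * beta t * pw (- rho) t) ->
  (\forall t \near \oo, q t.+1 <= (1 - mu * alpha t) * q t
     + C * alpha t * p t + C * beta t * pw (- rho) t) ->
  pw tau0 t * (p t + q t) @[t --> \oo] --> (0 : R).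
Proof.
move=> p0 q0 a0 b0 c0 C0 mu0 tau00 tau11 tau20 tau21 Hk Hrho Hmu alpha beta Hp Hq.
(* An exponent strictly above [tau0] that still meets every strict upper bound; the surplus gives
   the limit 0 at the end. *)
have [tau' [tau0' Hk' Hrho' Hmu']] : exists tau', [/\ tau0 < tau',
    tau' + kappa < tau1 - tau2, tau' < rho + tau2 - tau1 &
    tau1 = 1 -> tau' < a * mu].
  pose m := Num.min (tau1 - tau2 - kappa) (rho + tau2 - tau1).
  pose u := if tau1 == 1 then Num.min m (a * mu) else m.
  have mu1 : u <= tau1 - tau2 - kappa.
    by rewrite /u; case: ifP => _; rewrite !ge_min lexx.
  have mu2 : u <= rho + tau2 - tau1.
    by rewrite /u; case: ifP => _; rewrite !ge_min lexx ?orbT.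
  have mu3 : tau1 = 1 -> u <= a * mu by rewrite /u => ->; rewrite eqxx ge_min lexx orbT.
  have u0 : tau0 < u.
    have Hm : tau0 < m by rewrite lt_min; apply/andP; split; lra.
    by rewrite /u; case: eqP => [/Hmu|]//; rewrite lt_min Hm => ->.
  exists ((tau0 + u) / 2); split; [lra..|move=> /mu3; lra].
have tau'0 : 0 <= tau' by lra.
(* [g] is what remains of the contraction of [q] after paying for the decay of [pw (- tau')]. For
   [tau1 = 1] both have order [1/(t+1)] and constants are compared; otherwise [alpha] dominates. *)
have [g [g0 gle]] : exists g, 0 < g /\
    \forall t \near \oo, tau' * pw (- 1) t <= (mu - g) * alpha t.
  have [t1|t1] := eqVneq tau1 1.
    exists (mu - tau' / a); split.
      by rewrite subr_gt0 ltr_pdivrMr// mulrC Hmu'.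
    by apply: nearW => t; rewrite /alpha t1 opprB addrC subrK mulrA divfK ?gt_eqF.
  exists (mu / 2); split; first by rewrite divr_gt0.
  have t1' : - 1 < - tau1 by rewrite ltrN2 lt_neqAle t1.
  have ee : 0 < (mu / 2) * a by rewrite mulr_gt0// divr_gt0.
  apply: filterS (pw_near_dom tau' t1' ee) => t /le_trans; apply.
  by rewrite /alpha mulrA ler_wpM2r ?pw_ge0// ler_wpM2r ?(ltW a0)//; lra.
(* The influence of [p] on [q] then costs at most half of [g]; the other half covers the threshold
   term. *)
pose eps := Num.min 1 (g / (2 * (C + 1))).
have C1 : 0 < C + 1 by lra.
have eps0 : 0 < eps by rewrite lt_min ltr01 divr_gt0// mulr_gt0.
have eps1 : eps <= 1 by rewrite ge_min lexx.
have epsC : C * eps <= g / 2.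
  apply: (@le_trans _ _ ((C + 1) * (g / (2 * (C + 1))))).
    apply: ler_pM => //; [exact: ltW|lra|by rewrite ge_min lexx orbT].
  by rewrite le_eqVlt; apply/orP; left; apply/eqP; field; rewrite gt_eqF.
(* The budget [c * eps] has five shares: the decay of [pw (- tau')], the feedback of [p] on itself,
   the influence of [q], the noise term and the threshold term. *)
pose E := c * eps / 5.
have E0 : 0 < E by rewrite divr_gt0// mulr_gt0.
have Eb0 : 0 < E * b by rewrite mulr_gt0.
have N1 : \forall t \near \oo, c * beta t <= 1.
  apply: filterS (pw_near_le (c * b) (_ : - tau2 < 0) ltr01); last by rewrite oppr_lt0.
  by move=> t; rewrite /beta mulrA.
have N2 : \forall t \near \oo, C * alpha t <= E * beta t.
  apply: filterS (pw_near_dom (C * a) (_ : - tau1 < - tau2) Eb0); last by lra.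
  by move=> t; rewrite /alpha /beta !mulrA.
have N3 : \forall t \near \oo, C * alpha t * pw kappa t <= E * beta t * pw (- tau') t.
  apply: filterS (pw_near_dom (C * a) (_ : - tau1 + kappa < - tau2 - tau') Eb0); last by lra.
  by move=> t; rewrite !pwD /alpha /beta !mulrA.
have N4 : \forall t \near \oo, C * beta t * pw (- rho) t <= E * beta t * pw (- tau') t.
  apply: filterS (pw_near_dom (C * b) (_ : - tau2 - rho < - tau2 - tau') Eb0); last by lra.
  by move=> t; rewrite !pwD /alpha /beta !mulrA.
have N5 : \forall t \near \oo, eps * tau' * pw (- 1) t <= E * beta t.
  apply: filterS (pw_near_dom (eps * tau') (_ : - 1 < - tau2) Eb0); last by lra.
  by move=> t; rewrite /beta !mulrA.
have ga0 : 0 < g / 2 * a by rewrite mulr_gt0// divr_gt0.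
have N6 : \forall t \near \oo, C * beta t * pw (- rho) t <= g / 2 * alpha t * pw (- tau') t.
  apply: filterS (pw_near_dom (C * b) (_ : - tau2 - rho < - tau1 - tau') ga0); last by lra.
  by move=> t; rewrite !pwD /alpha /beta !mulrA.
have N7 : \forall t \near \oo, mu * alpha t <= 1.
  apply: filterS (pw_near_le (mu * a) (_ : - tau1 < 0) ltr01); last by lra.
  by move=> t; rewrite /alpha mulrA.
have [T0 _ HT] : \forall t \near \oo, [/\ [/\
    p t.+1 <= (1 - c * beta t) * p t + C * alpha t * (p t + q t)
      + C * alpha t * pw kappa t + C * beta t * pw (- rho) t,
    q t.+1 <= (1 - mu * alpha t) * q t + C * alpha t * p t + C * beta t * pw (- rho) t &
    tau' * pw (- 1) t <= (mu - g) * alpha t],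
    [/\ c * beta t <= 1, C * alpha t <= E * beta t,
       C * alpha t * pw kappa t <= E * beta t * pw (- tau') t &
       C * beta t * pw (- rho) t <= E * beta t * pw (- tau') t] &
    [/\ eps * tau' * pw (- 1) t <= E * beta t,
       C * beta t * pw (- rho) t <= g / 2 * alpha t * pw (- tau') t &
       mu * alpha t <= 1]].
  by near=> t; split; split; near: t.
(* The quotient secures both bounds at [T0]; [M >= 1] lets the source terms, which carry no [M], be
   bounded by [M] times themselves. *)
pose M := Num.max 1 ((p T0 + q T0) / (eps * pw (- tau') T0)).
have M1 : 1 <= M by rewrite le_max lexx.
have M0 : 0 < M by apply: lt_le_trans M1.
have bnd k : p (T0 + k)%N <= M * eps * pw (- tau') (T0 + k)%N /\
             q (T0 + k)%N <= M * pw (- tau') (T0 + k)%N.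
  elim: k => [|k [IHp IHq]].
    rewrite addn0; have S0 := pw_gt0 (- tau') T0.
    have H : p T0 + q T0 <= M * eps * pw (- tau') T0.
      by rewrite -mulrA -ler_pdivrMr ?mulr_gt0// le_max lexx orbT.
    split; first by have := q0 T0; lra.
    apply: le_trans (_ : M * eps * pw (- tau') T0 <= _); first by have := p0 T0; lra.
    by rewrite ler_wpM2r ?pw_ge0// ler_piMr// ltW.
  rewrite addnS; set s := (T0 + k)%N in IHp IHq *.
  have [[H1 H2 H3] [H4 H5 H6 H7] [H8 H9 H10]] := HT s (leq_addr _ _).
  have D := pw_decay s tau'0.
  have al0 : 0 <= alpha s by rewrite mulr_ge0 ?pw_ge0// ltW.
  have be0 : 0 <= beta s by rewrite mulr_ge0 ?pw_ge0// ltW.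
  move: D H1 H2 H3 H4 H5 H6 H7 H8 H9 H10 IHp IHq (pw_ge0 (- tau') s) (p0 s) (q0 s).
  move: (alpha s) (beta s) (pw (- tau') s) (pw (- tau') s.+1) (pw kappa s)
    (pw (- rho) s) (pw (- 1) s) (p s) (q s) al0 be0.
  move=> A B S S' K Rr I ps qs A0 B0 D H1 H2 H3 H4 H5 H6 H7 H8 H9 H10 IHp IHq S0 ps0 qs0.
  have MS0 : 0 <= M * S by rewrite mulr_ge0// ltW.
  have EBS : E * B * S <= M * (E * B * S).
    by rewrite ler_peMl// !mulr_ge0// ltW.
  have gAS : g / 2 * A * S <= M * (g / 2 * A * S).
    by rewrite ler_peMl// !mulr_ge0// ltW.
  split.
  - have K1 : (1 - c * B + C * A) * ps <= (1 - c * B + C * A) * (M * eps * S).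
      rewrite ler_wpM2l// addr_ge0// ?subr_ge0// mulr_ge0//.
    have K2 : C * A * qs <= C * A * (M * S) by rewrite ler_wpM2l// mulr_ge0.
    have K3 : (1 - c * B + C * A) * eps + C * A + 2 * (E * B) <= eps * (1 - tau' * I).
      have : C * A * eps <= C * A by rewrite ler_piMr// mulr_ge0.
      have : E * 5 = c * eps by rewrite /E divfK.
      move=> E5; have : E * 5 * B = c * eps * B by rewrite E5.
      lra.
    have K4 := ler_wpM2l MS0 K3.
    have K5 : M * eps * ((1 - tau' * I) * S) <= M * eps * S'.
      by rewrite ler_wpM2l// mulr_ge0// ltW.
    lra.
  - have K1 : (1 - mu * A) * qs <= (1 - mu * A) * (M * S).
      by rewrite ler_wpM2l// subr_ge0.
    have K2 : C * A * ps <= C * A * (M * eps * S) by rewrite ler_wpM2l// mulr_ge0.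
    have K3 : C * eps * (A * (M * S)) <= g / 2 * (A * (M * S)).
      by rewrite ler_wpM2r// mulr_ge0.
    have K4 := ler_wpM2l MS0 H3.
    have K5 : M * ((1 - tau' * I) * S) <= M * S' by rewrite ler_wpM2l// ltW.
    lra.
have lim0 : 2 * M * pw (tau0 - tau') t @[t --> \oo] --> (0 : R).
  have -> : (0 : R) = 2 * M * 0 by rewrite mulr0.
  by apply: cvgMl_tmp; apply: pw_cvg0; rewrite subr_lt0.
apply: (squeeze_cvgr _ (cvg_cst _) lim0).
exists T0 => // t /= T0t; rewrite mulr_ge0 ?pw_ge0 ?addr_ge0//=.
have := bnd (t - T0)%N; rewrite subnKC// => -[Hpt Hqt].
rewrite pwD mulrCA ler_wpM2l ?pw_ge0//.
have : eps * (M * pw (- tau') t) <= M * pw (- tau') t.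
  by rewrite ler_piMl// mulr_ge0 ?pw_ge0// ltW.
lra.
Unshelve. all: by end_near.
Qed.
End Comparison.

(** * Inner products and symmetric matrices *)

Section InnerProduct.
Variables (R : realType) (V : lmodType R) (dot : V -> V -> R).
Hypothesis dotC : forall x y, dot x y = dot y x.
Hypothesis dotDl : forall x y z, dot (x + y) z = dot x z + dot y z.
Hypothesis dotZl : forall c x y, dot (c *: x) y = c * dot x y.
Hypothesis dot_ge0 : forall x, 0 <= dot x x.

Lemma dot_sqD c x y :
  dot (x + c *: y) (x + c *: y) = dot x x + c * dot x y *+ 2 + c ^+ 2 * dot y y.
Proof.
rewrite dotDl ![dot _ (x + _)]dotC !dotDl !dotZl ![dot _ (c *: _)]dotC !dotZl.
by rewrite (dotC y x); ring.
Qed.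

(** [dot] may be degenerate, as the form [x^T A y] is a priori. If [dot y y > 0], the difference of
    [x] and its projection on [y] has a nonnegative square. *)
Lemma cauchy_schwarz x y : dot x y ^+ 2 <= dot x x * dot y y.
Proof.
have [y0|y0] := eqVneq (dot y y) 0; last first.
  have yy0 : 0 < dot y y by rewrite lt_neqAle eq_sym y0 dot_ge0.
  have := dot_ge0 (x + (- (dot x y / dot y y)) *: y).
  rewrite dot_sqD -(ler_pM2l yy0) mulr0.
  rewrite [leRHS](_ : _ = dot x x * dot y y - dot x y ^+ 2) ?subr_ge0//.
  by field.
(* the discriminant argument degenerates when [dot y y = 0] *)
rewrite y0 mulr0; case: (eqVneq (dot x y) 0) => [->|xy0]; first by rewrite expr0n.
have := dot_ge0 (x + (- (dot x x + 1) / (dot x y *+ 2)) *: y).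
rewrite dot_sqD y0 mulr0 addr0.
have -> : dot x x + - (dot x x + 1) / (dot x y *+ 2) * dot x y *+ 2 = -1.
  by field.
by rewrite ler0N1.
Qed.

Definition dnorm x := Num.sqrt (dot x x).

Lemma dnorm_sq x : dnorm x ^+ 2 = dot x x.
Proof. exact/sqr_sqrtr/dot_ge0. Qed.

Lemma ler_dnormD x y : dnorm (x + y) <= dnorm x + dnorm y.
Proof.
rewrite -ler_sqr ?nnegrE ?addr_ge0 ?sqrtr_ge0// dnorm_sq.
rewrite -[y in leLHS]scale1r dot_sqD sqrrD !dnorm_sq mul1r expr1n mul1r.
rewrite lerD2r lerD2l lerMn2r//= (le_trans (ler_norm _))//.
rewrite -ler_sqr ?nnegrE ?mulr_ge0 ?sqrtr_ge0// exprMn !dnorm_sq real_normK ?num_real//.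
exact: cauchy_schwarz.
Qed.

Lemma dnormZ c x : dnorm (c *: x) = `|c| * dnorm x.
Proof.
by rewrite /dnorm dotZl dotC dotZl mulrA -expr2 sqrtrM ?sqr_ge0// sqrtr_sqr.
Qed.

(** Expanding gives [|x - s y|^2 <= (1 - 2 s c + s^2 K) |x|^2]; the last condition pays for the
    quadratic term with the loss from [c] to [c']. *)
Lemma dnorm_gradient_step (c c' K s : R) x y :
  c * dot x x <= dot x y -> dot y y <= K * dot x x ->
  0 <= s -> s * c' <= 1 -> s * K <= (c - c') *+ 2 ->
  dnorm (x - s *: y) <= (1 - s * c') * dnorm x.
Proof.
move=> Hc HK s0 sc sK; have sc0 : 0 <= 1 - s * c' by rewrite subr_ge0.
rewrite -ler_sqr ?nnegrE ?mulr_ge0 ?sqrtr_ge0// exprMn !dnorm_sq -scaleNr dot_sqD.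
have xx := dot_ge0 x.
have H1 := ler_wpM2l s0 Hc.
have H2 := ler_wpM2l (sqr_ge0 s) HK.
have H3 := ler_wpM2r xx (ler_wpM2l s0 sK).
have H4 := mulr_ge0 (sqr_ge0 (s * c')) xx.
by lra.
Qed.
End InnerProduct.

(** * Euclidean norm of columns and norm bounds for matrices *)

Section Columns.
Variable R : realType.

Definition cdot n (x y : 'cV[R]_n) : R := \sum_j x j 0 * y j 0.

Variable n : nat.
Implicit Types x y z : 'cV[R]_n.

Lemma cdotC x y : cdot x y = cdot y x.
Proof. by apply: eq_bigr => j _; rewrite mulrC. Qed.

Lemma cdotDl x y z : cdot (x + y) z = cdot x z + cdot y z.
Proof. by rewrite -big_split; apply: eq_bigr => j _; rewrite mxE mulrDl. Qed.

Lemma cdotZl c x y : cdot (c *: x) y = c * cdot x y.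
Proof. by rewrite mulr_sumr; apply: eq_bigr => j _; rewrite mxE mulrA. Qed.

Lemma cdot0l y : cdot 0 y = 0.
Proof. by rewrite -(scale0r 0) cdotZl mul0r. Qed.

Lemma cdotNl x y : cdot (- x) y = - cdot x y.
Proof. by rewrite -scaleN1r cdotZl mulN1r. Qed.

Lemma cdot_suml (I : Type) (r : seq I) (Q : pred I) (F : I -> 'cV[R]_n) y :
  cdot (\sum_(i <- r | Q i) F i) y = \sum_(i <- r | Q i) cdot (F i) y.
Proof.
elim/big_ind2: _ => [|x a z b <- <-|//]; [exact: cdot0l|exact: cdotDl].
Qed.

Lemma cdot_ge0 x : 0 <= cdot x x.
Proof. by apply: sumr_ge0 => j _; rewrite -expr2 sqr_ge0. Qed.

Lemma cdot_eq0 x : (cdot x x == 0) = (x == 0).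
Proof.
apply/idP/eqP => [|->]; last first.
  by rewrite cdot0l.
rewrite psumr_eq0 => [/allP H|j _]; last by rewrite -expr2 sqr_ge0.
apply/matrixP => j k; rewrite ord1 mxE; apply/eqP.
by have /= := H j (mem_index_enum _); rewrite mulf_eq0 orbb.
Qed.

Lemma enormE x : enorm x = dnorm (@cdot n) x.
Proof. by congr Num.sqrt; apply: eq_bigr => j _; rewrite expr2. Qed.

Lemma enorm_ge0 x : 0 <= enorm x.
Proof. exact: sqrtr_ge0. Qed.

Lemma enorm_sq x : enorm x ^+ 2 = cdot x x.
Proof. by rewrite enormE dnorm_sq//; exact: cdot_ge0. Qed.

Lemma ler_enormD x y : enorm (x + y) <= enorm x + enorm y.
Proof.
rewrite !enormE; apply: ler_dnormD; [exact: cdotC|exact: cdotDl|exact: cdotZl|exact: cdot_ge0].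
Qed.

Lemma enormZ c x : enorm (c *: x) = `|c| * enorm x.
Proof. rewrite !enormE; apply: dnormZ; [exact: cdotC|exact: cdotZl]. Qed.

Lemma enormN x : enorm (- x) = enorm x.
Proof. by rewrite -scaleN1r enormZ normrN1 mul1r. Qed.

Lemma enorm0 : enorm (0 : 'cV[R]_n) = 0.
Proof. by rewrite -(scale0r 0) enormZ normr0 mul0r. Qed.

Lemma ler_enorm_sum (I : Type) (r : seq I) (Q : pred I) (F : I -> 'cV[R]_n) :
  enorm (\sum_(i <- r | Q i) F i) <= \sum_(i <- r | Q i) enorm (F i).
Proof.
elim/big_ind2: _ => //; first by rewrite enorm0.
by move=> x a y b xa yb; rewrite (le_trans (ler_enormD _ _))// lerD.
Qed.

Lemma ler_coord_enorm x j : `|x j 0| <= enorm x.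
Proof.
rewrite -sqrtr_sqr ler_sqrt ?sumr_ge0// => [|i _]; last exact: sqr_ge0.
by rewrite (bigD1 j)//= lerDl sumr_ge0// => i _; rewrite sqr_ge0.
Qed.

Lemma ler_enorm_l1 x : enorm x <= \sum_j `|x j 0|.
Proof.
have H0 : 0 <= \sum_j `|x j 0| by apply: sumr_ge0.
rewrite -(ger0_norm H0) -sqrtr_sqr ler_sqrt ?sqr_ge0//.
rewrite expr2 mulr_suml ler_sum// => j _.
rewrite -(real_normK (num_real _)) expr2 ler_wpM2l//.
by rewrite (bigD1 j)//= lerDl sumr_ge0.
Qed.

Definition mxbound p (A : 'M[R]_(p, n)) := \sum_j enorm (col j A).

Lemma mxbound_ge0 p (A : 'M[R]_(p, n)) : 0 <= mxbound A.
Proof. by apply: sumr_ge0 => j _; exact: sqrtr_ge0. Qed.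

End Columns.

Lemma ler_enorm_mulmx (R : realType) p n (A : 'M[R]_(p, n)) (x : 'cV[R]_n) :
  enorm (A *m x) <= mxbound A * enorm x.
Proof.
have -> : A *m x = \sum_j x j 0 *: col j A.
  apply/matrixP => i k; rewrite ord1 !mxE summxE; apply: eq_bigr => j _.
  by rewrite !mxE mulrC.
rewrite (le_trans (ler_enorm_sum _ _ _))// mulr_suml ler_sum// => j _.
by rewrite enormZ mulrC ler_wpM2l ?enorm_ge0// ler_coord_enorm.
Qed.

(** * Coercivity and least eigenvalue of symmetric matrices *)

Section SymmetricMatrices.
Variables (R : realType) (n : nat).
Implicit Types (A : 'M[R]_n) (x y : 'cV[R]_n).

Lemma cdot_mulmxl p (B : 'M[R]_(p, n)) (u : 'cV[R]_p) x :
  cdot u (B *m x) = cdot (B^T *m u) x.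
Proof.
have E k (w v : 'cV[R]_k) : cdot w v = (w^T *m v) 0 0.
  by rewrite mxE; apply: eq_bigr => j _; rewrite mxE.
by rewrite !E trmx_mul trmxK mulmxA.
Qed.

(* Cauchy-Schwarz for the semi-inner product [x^T A y], applied to [x] and
   [A^-1 x]: no spectral decomposition or compactness is needed. *)
Lemma psd_unit_coercive A : A^T = A -> (forall x, 0 <= cdot x (A *m x)) ->
  A \in unitmx -> exists2 c, 0 < c & forall x, c * cdot x x <= cdot x (A *m x).
Proof.
move=> AT A0 Au; pose D x y := cdot x (A *m y).
have DC x y : D x y = D y x by rewrite /D cdot_mulmxl AT cdotC.
have DD x y z : D (x + y) z = D x z + D y z by rewrite /D cdotDl.
have DZ c x y : D (c *: x) y = c * D x y by rewrite /D cdotZl.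
pose K := mxbound (invmx A) + 1.
have K0 : 0 < K by rewrite ltr_wpDl ?mxbound_ge0.
exists K^-1; rewrite ?invr_gt0// => x; rewrite mulrC ler_pdivrMr//.
have [xx0|xx0] := eqVneq (cdot x x) 0; first by rewrite xx0 mulr_ge0 ?A0// ltW.
have xx : 0 < cdot x x by rewrite lt_neqAle eq_sym xx0 cdot_ge0.
(* Since [A (A^-1 x) = x], this reads [(x.x)^2 <= (x.Ax) (x.A^-1 x)], and the last factor is at most
   [K (x.x)]. *)
have := @cauchy_schwarz R _ D DC DD DZ A0 x (invmx A *m x).
rewrite /D mulKVmx// cdotC => CS.
have xAx : 0 <= cdot (A *m x) x by rewrite cdotC.
rewrite -(ler_pM2r xx) -expr2 (le_trans CS)// -mulrA ler_wpM2l//.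
have CS2 := @cauchy_schwarz R _ _ (@cdotC R n) (@cdotDl R n) (@cdotZl R n) (@cdot_ge0 R n)
  (invmx A *m x) x.
have Hb : enorm (invmx A *m x) <= K * enorm x.
  rewrite (le_trans (ler_enorm_mulmx _ _))// ler_wpM2r ?enorm_ge0//.
  by rewrite lerDl.
rewrite -!enorm_sq; apply: le_trans (_ : enorm (invmx A *m x) * enorm x <= _).
  rewrite (le_trans (ler_norm _))// -ler_sqr ?nnegrE ?mulr_ge0 ?enorm_ge0//.
  by rewrite real_normK ?num_real// exprMn !enorm_sq.
by rewrite expr2 mulrA ler_wpM2r ?enorm_ge0.
Qed.

(* The eigenvalue is the largest [s] such that [A - s] is positive semidefinite:
   if [A - s] were invertible, it would be coercive and [s] could be increased. *)
Lemma min_eigenvalue_rayleigh A : (0 < n)%N -> A^T = A ->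
  (forall x, 0 <= cdot x (A *m x)) -> A \in unitmx ->
  exists l, [/\ 0 < l, is_min_eigenvalue A l &
    forall x, l * cdot x x <= cdot x (A *m x)].
Proof.
move=> n0 AT A0 Au; have [c c0 Hc] := psd_unit_coercive AT A0 Au.
pose S := [set s : R | forall x, s * cdot x x <= cdot x (A *m x)].
have Sc : S c by [].
(* Any nonzero vector bounds [S] above by its Rayleigh quotient; [n > 0] makes this one nonzero. *)
pose e : 'cV[R]_n := const_mx 1.
have e0 : 0 < cdot e e.
  rewrite lt_neqAle cdot_ge0 andbT eq_sym cdot_eq0.
  apply/eqP => /matrixP /(_ (Ordinal n0) 0); rewrite !mxE => /eqP.
  by rewrite oner_eq0.
have Sup : has_sup S.
  split; first by exists c.
  by exists (cdot e (A *m e) / cdot e e) => s /(_ e); rewrite ler_pdivlMr.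
have Ssup : S (sup S).
  move=> x; have [->|xx0] := eqVneq (cdot x x) 0; first by rewrite mulr0 A0.
  have xx : 0 < cdot x x by rewrite lt_neqAle eq_sym xx0 cdot_ge0.
  rewrite -ler_pdivlMr//; apply: ge_sup => [|s /(_ x)]; first by exists c.
  by rewrite ler_pdivlMr.
have lub s : S s -> s <= sup S by apply: ub_le_sup; case: Sup.
exists (sup S); split => //; first exact: lt_le_trans (lub _ Sc).
split.
  have HB x : cdot x ((A - (sup S)%:M) *m x) = cdot x (A *m x) - sup S * cdot x x.
    rewrite mulmxBl mul_scalar_mx cdotC -scaleNr cdotDl cdotZl mulNr.
    by rewrite [cdot (A *m x) x]cdotC.
  rewrite /eigenvalue /eigenspace kermx_eq0 row_free_unit; apply/negP => Bu.
  have BT : (A - (sup S)%:M)^T = A - (sup S)%:M by rewrite linearB/= AT tr_scalar_mx.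
  have B0 x : 0 <= cdot x ((A - (sup S)%:M) *m x) by rewrite HB subr_ge0.
  have [c' c'0 Hc'] := psd_unit_coercive BT B0 Bu.
  have /lub : S (sup S + c') by move=> x; have := Hc' x; rewrite HB mulrDl; lra.
  by rewrite gerDl leNgt c'0.
(* Eigenvectors are rows here; by symmetry the transpose is a column eigenvector, on which [sup S]
   is tested. *)
move=> l /eigenvalueP[w wA w0]; have := Ssup w^T.
have -> : A *m w^T = l *: w^T by rewrite -linearZ/= -wA trmx_mul AT.
rewrite (cdotC _ (l *: _)) cdotZl ler_pM2r//.
by rewrite lt_neqAle cdot_ge0 andbT eq_sym cdot_eq0 trmx_eq0.
Qed.
End SymmetricMatrices.

Section Gram.
Variables (R : realType) (N n : nat) (m : 'I_N -> nat) (H : forall i, 'M[R]_(m i, n)).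

Lemma gram_tr : (gram H)^T = gram H.
Proof. by rewrite /gram linear_sum; apply: eq_bigr => i _; rewrite /= trmx_mul trmxK. Qed.

Lemma cdot_gram_ge0 x : 0 <= cdot x (gram H *m x).
Proof.
rewrite cdotC /gram mulmx_suml.
elim/big_ind: _ => [|y z y0 z0|i _]; last first.
- by rewrite cdotC -mulmxA cdot_mulmxl trmxK cdot_ge0.
- by rewrite cdotDl addr_ge0.
- by rewrite cdot0l.
Qed.

Lemma gram_unit : \rank (gram H) = n -> gram H \in unitmx.
Proof. by move=> r; rewrite -row_full_unit /row_full r. Qed.
End Gram.

(* [Q] records the step-size condition; when [n = 0] there is no eigenvalue and
   any [l] satisfying [Q] will do. *)
Lemma gram_rayleigh_bound (R : realType) N n (m : 'I_N -> nat)
    (H : forall i, 'M[R]_(m i, n)) (Q : R -> Prop) :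
  \rank (gram H) = n -> (exists2 l, 0 < l & Q l) ->
  (forall l, is_min_eigenvalue (gram H) l -> Q l) ->
  exists l, [/\ 0 < l, Q l & forall x, l * cdot x x <= cdot x (gram H *m x)].
Proof.
move=> rk [l l0 Ql] HQ; have [n0|n0] := posnP n.
  exists l; split=> // x.
  have -> : x = 0 by apply/matrixP => -[k kn]; case: (notF); rewrite -(ltn0 k) -n0.
  by rewrite mulmx0 cdot0l mulr0.
have [l' [? ? ?]] := min_eigenvalue_rayleigh n0 (gram_tr H) (cdot_gram_ge0 H) (gram_unit rk).
by exists l'; split=> //; exact: HQ.
Qed.

(** * Graph Laplacian *)

Section Disagreement.
Variables (R : realType) (N n : nat).
Implicit Types z w : 'I_N -> 'cV[R]_n.

Definition sdot z w : R := \sum_i cdot (z i) (w i).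
Definition snorm z : R := dnorm sdot z.

Lemma sdotC z w : sdot z w = sdot w z.
Proof. by apply: eq_bigr => i _; exact: cdotC. Qed.

Lemma sdotDl z z' w : sdot (z + z') w = sdot z w + sdot z' w.
Proof. by rewrite -big_split; apply: eq_bigr => i _; exact: cdotDl. Qed.

Lemma sdotZl c z w : sdot (c *: z) w = c * sdot z w.
Proof. by rewrite mulr_sumr; apply: eq_bigr => i _; exact: cdotZl. Qed.

Lemma sdot_ge0 z : 0 <= sdot z z.
Proof. by apply: sumr_ge0 => i _; exact: cdot_ge0. Qed.

Lemma snorm_ge0 z : 0 <= snorm z.
Proof. exact: sqrtr_ge0. Qed.

Lemma ler_snormD z w : snorm (z + w) <= snorm z + snorm w.
Proof.
apply: ler_dnormD; [exact: sdotC|exact: sdotDl|exact: sdotZl|exact: sdot_ge0].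
Qed.

Lemma ler_enorm_snorm z i : enorm (z i) <= snorm z.
Proof.
rewrite enormE ler_sqrt ?sdot_ge0//.
by rewrite /sdot (bigD1 i)//= lerDl sumr_ge0// => j _; exact: cdot_ge0.
Qed.

(** The optimal factor is the square root of [N]; [N <= N^2] gives this simpler one. *)
Lemma ler_snorm_sup z K : 0 <= K -> (forall i, enorm (z i) <= K) -> snorm z <= N%:R * K.
Proof.
move=> K0 zK.
have NK : 0 <= N%:R * K by rewrite mulr_ge0.
rewrite -[leRHS](ger0_norm NK) -sqrtr_sqr ler_sqrt ?sqr_ge0//.
apply: le_trans (_ : N%:R * K ^+ 2 <= _).
  rewrite mulr_natl -[X in _ *+ X]card_ord -sumr_const; apply: ler_sum => i _.
  by rewrite -enorm_sq ler_sqr ?nnegrE ?enorm_ge0// zK.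
rewrite exprMn ler_wpM2r ?sqr_ge0// -natrX ler_nat expnS expn1.
by case: (N) => // k; rewrite leq_pmulr.
Qed.

Variable adj : rel 'I_N.
Hypothesis adj_sym : forall i j, adj i j = adj j i.

(** The Kronecker product of the graph Laplacian with the identity, acting on the stacked vector. *)
Definition laplacian z : 'I_N -> 'cV[R]_n := fun i => \sum_(j < N | adj i j) (z i - z j).

(** An edge contributes opposite terms at its two ends, so exchanging the sums negates the total. *)
Lemma sum_laplacian z : \sum_i laplacian z i = 0.
Proof.
have E : \sum_i laplacian z i = - \sum_i laplacian z i.
  rewrite /laplacian; under eq_bigr do rewrite big_mkcond.
  rewrite {1}exchange_big/= -sumrN; apply: eq_bigr => i _.
  rewrite -sumrN; apply: eq_bigr => j _; rewrite adj_sym.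
  by case: ifP; rewrite ?oppr0// opprB.
have /eqP : 2%:R *: \sum_i laplacian z i = 0 by rewrite scaler_nat mulr2n {2}E subrr.
by rewrite scaler_eq0 pnatr_eq0 => /eqP.
Qed.

(** Summation by parts: the energy of [z], each edge being counted in both directions. *)
Lemma sdot_laplacian z :
  sdot z (laplacian z) *+ 2 =
  \sum_i \sum_(j < N | adj i j) cdot (z i - z j) (z i - z j).
Proof.
have E : sdot z (laplacian z) = \sum_i \sum_(j < N | adj i j) cdot (z i) (z i - z j).
  apply: eq_bigr => i _; rewrite cdotC cdot_suml.
  by apply: eq_bigr => j _; rewrite cdotC.
have E' : sdot z (laplacian z) = \sum_i \sum_(j < N | adj i j) cdot (- z j) (z i - z j).
  rewrite E; under eq_bigr do rewrite big_mkcond.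
  rewrite exchange_big/=; apply: eq_bigr => i _.
  rewrite [RHS]big_mkcond; apply: eq_bigr => j _; rewrite adj_sym.
  by case: ifP => // _; rewrite cdotNl -[z j - z i]opprB cdotC cdotNl cdotC.
rewrite mulr2n {1}E E' -big_split; apply: eq_bigr => i _ /=.
by rewrite -big_split; apply: eq_bigr => j _ /=; rewrite -cdotDl.
Qed.

Lemma cdot_sqrB2 (x y : 'cV[R]_n) :
  cdot (x + y) (x + y) <= 2 * cdot x x + 2 * cdot y y.
Proof.
have -> : 2 * cdot x x + 2 * cdot y y = cdot (x + y) (x + y) + cdot (x - y) (x - y).
  rewrite -[X in x + X]scale1r -[X in x - X]scale1r -scaleNr.
  rewrite !(@dot_sqD R _ (@cdot R n) (@cdotC R n) (@cdotDl R n) (@cdotZl R n)).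
  by ring.
by rewrite lerDl cdot_ge0.
Qed.

Hypothesis adj_conn : forall i j, connect adj i j.

(** Induction along a path from [i] to [j], each edge of which costs a bounded multiple of the
    energy. *)
Lemma edge_energy i j : exists2 K, 0 <= K &
  forall z, cdot (z i - z j) (z i - z j) <= K * sdot z (laplacian z).
Proof.
have en0 z : 0 <= sdot z (laplacian z).
  rewrite -(pmulrn_lge0 _ (ltn0Sn 1)) sdot_laplacian.
  by do 2![apply: sumr_ge0 => ? _]; exact: cdot_ge0.
have /connectP[s] := adj_conn i j.
elim: s i => [|k s IH] i /=.
  by move=> _ ->; exists 0 => // z; rewrite subrr mul0r cdot0l.
move=> /andP[ik ks] jl; have [K K0 HK] := IH k ks jl.
(* The outer factors 2 come from [cdot_sqrB2], the inner one from the doubled energy in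
   [sdot_laplacian]. *)
exists (2 * 2 + 2 * K) => [|z]; first by rewrite addr_ge0 ?mulr_ge0.
have -> : z i - z j = (z i - z k) + (z k - z j) by rewrite addrA subrK.
rewrite (le_trans (cdot_sqrB2 _ _))// [leRHS]mulrDl -2!mulrA lerD// ler_pM2l//.
rewrite mulr_natl sdot_laplacian (bigD1 i)//= (bigD1 k)//= -addrA lerDl addr_ge0//.
  by apply: sumr_ge0 => ? _; exact: cdot_ge0.
by do 2![apply: sumr_ge0 => ? _]; exact: cdot_ge0.
Qed.

(** A Poincare inequality, the quantitative form of [lambda_2 > 0]: pairwise differences control a
    family of sum zero, and the energy controls these differences. *)
Lemma laplacian_coercive : (0 < N)%N -> exists2 c, 0 < c &
  forall z, \sum_i z i = 0 -> c * sdot z z <= sdot z (laplacian z).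
Proof.
move=> N0.
have /choice[K HK] : forall ij : 'I_N * 'I_N, exists K, 0 <= K /\
    forall z, cdot (z ij.1 - z ij.2) (z ij.1 - z ij.2) <= K * sdot z (laplacian z).
  by move=> [i j]; have [K ? ?] := edge_energy i j; exists K.
pose K' := \sum_i \sum_j K (i, j) + 1.
have K'0 : 0 < K'.
  by rewrite ltr_wpDl//; do 2![apply: sumr_ge0 => ? _]; exact: (HK _).1.
exists (K'^-1); rewrite ?invr_gt0// => z z0.
have en0 : 0 <= sdot z (laplacian z).
  rewrite -(pmulrn_lge0 _ (ltn0Sn 1)) sdot_laplacian.
  by do 2![apply: sumr_ge0 => ? _]; exact: cdot_ge0.
rewrite mulrC ler_pdivrMr//.
(* for a family summing to zero, the pairwise squared distances add up to [2 N |z|^2] *)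
have E : \sum_i \sum_j cdot (z i - z j) (z i - z j) = N%:R * sdot z z *+ 2.
  have expand i j : cdot (z i - z j) (z i - z j) =
      cdot (z i) (z i) + cdot (z j) (z j) - cdot (z j) (z i) *+ 2.
    rewrite -[X in _ - X]scale1r -scaleNr.
    rewrite (@dot_sqD R _ (@cdot R n) (@cdotC R n) (@cdotDl R n) (@cdotZl R n)).
    by rewrite (cdotC (z j)); ring.
  have cross i : \sum_j cdot (z j) (z i) = 0.
    by rewrite -cdot_suml z0 cdot0l.
  under eq_bigr => i _.
    under eq_bigr do rewrite expand.
    rewrite big_split/= big_split/= sumrN sumrMnl cross mul0rn subr0 sumr_const card_ord.
    over.
  rewrite big_split/= sumr_const card_ord sumrMnl -/(sdot z z).
  by rewrite [in RHS]mulr_natl mulr2n.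
have bnd : \sum_i \sum_j cdot (z i - z j) (z i - z j) <= K' * sdot z (laplacian z).
  apply: le_trans (_ : (\sum_i \sum_j K (i, j)) * sdot z (laplacian z) <= _).
    rewrite mulr_suml ler_sum// => i _; rewrite mulr_suml ler_sum// => j _.
    exact: (HK (i, j)).2.
  by rewrite ler_wpM2r// lerDl.
rewrite mulrC; apply: le_trans bnd; rewrite E.
have z2 := sdot_ge0 z.
have : sdot z z <= N%:R * sdot z z by rewrite ler_peMl// ler1n.
by rewrite mulr2n; lra.
Qed.

Lemma laplacian_bound : exists2 K, 0 <= K &
  forall z, sdot (laplacian z) (laplacian z) <= K * sdot z z.
Proof.
pose K := N%:R * (N%:R * 2) : R; exists (K ^+ 2); first exact: sqr_ge0.
move=> z; rewrite -[sdot z z](dnorm_sq sdot_ge0) -exprMn.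
rewrite -(dnorm_sq sdot_ge0) ler_sqr ?nnegrE ?sqrtr_ge0//; last first.
  by rewrite mulr_ge0 ?sqrtr_ge0// !mulr_ge0.
rewrite /K -mulrA; apply: ler_snorm_sup => [|i].
  by rewrite mulr_ge0 ?sqrtr_ge0// mulr_ge0.
apply: le_trans (ler_enorm_sum _ _ _) _; rewrite big_mkcond/=.
apply: le_trans (_ : \sum_(j < N) (2 * snorm z) <= _).
  apply: ler_sum => j _; case: ifP => _; last by rewrite mulr_ge0 ?snorm_ge0.
  rewrite (le_trans (ler_enormD _ _))// enormN mulr_natl mulr2n.
  by rewrite lerD// ler_enorm_snorm.
by rewrite sumr_const card_ord -[leLHS]mulr_natl mulrA.
Qed.
End Disagreement.

(** * Almost sure growth of the noise *)

Section NoiseGrowth.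
Context (R : realType) (d : measure_display) (T : measurableType d) (P : probability T R).
Local Open Scope ereal_scope.

(** Markov's inequality gives tails of order [(t+1)^(- kappa p)], summable because [kappa p > 1],
    and Borel-Cantelli concludes. Equality of the tails carries the moment at time 0 to all
    times. *)
Lemma ae_eventually_le_pw (X : nat -> T -> R) (kappa p : R) :
  (forall t, measurable_fun setT (X t)) ->
  (forall t (s : R), P [set w | (s < `|X t w|)%R] = P [set w | (s < `|X 0%N w|)%R]) ->
  (0 < p)%R -> (1 < kappa * p)%R ->
  \int[P]_w (`|X 0%N w| `^ p)%:E < +oo ->
  {ae P, forall w, \forall t \near \oo, (`|X t w| <= pw kappa t)%R}.
Proof.
move=> mX idX p0 kp fin.
pose F t := [set w | (pw kappa t < `|X t w|)%R].
have mabs t : measurable_fun setT (fun w => `|X t w|%R).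
  exact: measurableT_comp (@measurable_realfun.normr_measurable R setT) (mX t).
have mF t (s : R) : measurable [set w | (s < `|X t w|)%R].
  have := mabs t measurableT `]s, +oo[%classic (measurable_itv _).
  rewrite setTI; congr measurable; apply/seteqP; split=> w /=;
    by rewrite in_itv/= andbT.
set I := \int[P]_w _ in fin.
have I0 : 0 <= I by apply: integral_ge0 => w _; rewrite lee_fin powR_ge0.
pose J := fine I; have IJ : I = J%:E by rewrite fineK// ge0_fin_numE.
have J0 : (0 <= J)%R by rewrite -lee_fin -IJ.
have Ft t : P (F t) <= (J * pw (- (kappa * p)) t)%:E.
  rewrite idX pwN EFinM -IJ lee_pdivlMr ?pw_gt0//.
  have mpow : measurable_fun setT (fun w => ((`|X 0%N w| `^ p)%R)%:E).
    apply/measurable_EFinP.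
    exact: measurableT_comp (@measurable_powR R p) (mabs 0%N).
  (* Markov's inequality for the [p]-th power at level [(t+1)^(kappa p)]. *)
  have := @le_integral_comp_abse _ _ _ P setT measurableT
    (fun w => (`|X 0%N w| `^ p)%:E) (pw (kappa * p) t) id (@measurable_id _ _ setT)
    (fun _ h => h) (fun _ _ _ _ h => h) mpow (pw_gt0 _ _).
  rewrite setTI muleC => H; apply: le_trans (le_trans _ H) _.
    rewrite lee_wpmul2r ?lee_fin ?pw_ge0//; apply: le_measure; rewrite ?inE//.
      rewrite -[X in measurable X]setTI.
      apply: emeasurable_fun_c_infty => //.
      exact: measurableT_comp mpow.
    move=> w /= hw; rewrite lee_fin ger0_norm ?powR_ge0//.
    rewrite /pw powRrM ge0_ler_powR ?nnegrE ?powR_ge0//; last exact: ltW.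
    exact: ltW.
  rewrite le_eqVlt; apply/orP; left; apply/eqP; apply: eq_integral => w _ /=.
  by rewrite ger0_norm ?powR_ge0.
have sumF : \sum_(n <oo) P (F n) < +oo.
  pose r := (kappa * p - 1)%R; have r0 : (0 < r)%R by rewrite subr_gt0.
  apply: (@le_lt_trans _ _ (J * (1 + r^-1))%:E); last exact: ltry.
  apply: lime_le; first by apply: is_cvg_nneseries => n _ _; exact: measure_ge0.
  apply: nearW => n; apply: (@le_trans _ _ (\sum_(0 <= t < n) (J * pw (- (kappa * p)) t)%:E)).
    exact: lee_sum.
  rewrite sumEFin lee_fin -mulr_sumr ler_wpM2l//.
  have -> : (- (kappa * p) = - r - 1)%R by rewrite /r; lra.
  exact: sum_pw_le.
have neg : P.-negligible (lim_sup_set F).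
  have mlim : measurable (lim_sup_set F).
    apply: bigcap_measurable => [|k _]; first by exists 0%N.
    by apply: bigcup_measurable => j _; exact: mF.
  by apply/(negligibleP _ mlim); apply: lim_sup_set_cvg0 sumF => t; exact: mF.
(* Violating the bound infinitely often means lying in the upper limit of the events [F]. *)
apply: negligibleS neg => w /= nw n _; apply: contrapT => H.
apply: nw; exists n => // t /= nt; rewrite leNgt; apply/negP => Ht.
by apply: H; exists t.
Qed.
End NoiseGrowth.

(** The scalar estimate is applied to the finitely many coordinates, each dominated by the stacked
    norm; summing absolute values gives a constant common to all agents. *)
Lemma noise_growth (R : realType) d (T : measurableType d) (P : probability T R)
    N (m : 'I_N -> nat) (v : forall i : 'I_N, nat -> T -> 'cV[R]_(m i)) (eps kappa : R) :
  noise_measurable v -> noise_ident_distr P v -> 0 < eps -> noise_moment P v eps ->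
  1 / (2 + eps) < kappa ->
  {ae P, forall w, \forall t \near \oo, forall i,
    enorm (v i t w) <= (\sum_i (m i)%:R) * pw kappa t}.
Proof.
move=> mv idv eps0 mom kap.
have p0 : 0 < 2 + eps by rewrite addr_gt0.
have kp : 1 < kappa * (2 + eps) by rewrite -ltr_pdivrMr.
have coord i k : {ae P, forall w, \forall t \near \oo, `|v i t w k 0| <= pw kappa t}.
  apply: (ae_eventually_le_pw (p := 2 + eps)) => //.
  - (* Identity in law is only assumed on rectangles: here the one constraining
       only the coordinate [k] of [v i]. *)
    move=> t s.
    pose B (i' : 'I_N) (k' : 'I_(m i')) : set R :=
      if (i' == i) && (k' == k :> nat) then [set x | s < `|x|] else setT.
    have HB t' : [set w | s < `|v i t' w k 0|] = noise_event v t' B.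
      apply/seteqP; split => w /=.
        move=> sv i' k'; rewrite /B; case: ifP => // /andP[/eqP ii'].
        by move: k'; rewrite ii' => k' /eqP /val_inj ->.
      by move=> /(_ i k); rewrite /B !eqxx.
    rewrite !HB; apply: idv => i' k'; rewrite /B; case: ifP => // _.
    have -> : [set x : R | s < `|x|] = setT `&` Num.Def.normr @^-1` `]s, +oo[.
      by rewrite setTI; apply/seteqP; split=> x /=; rewrite in_itv/= andbT.
    exact: measurable_realfun.normr_measurable.
  - have m1 : measurable_fun setT (fun w => (`|v i 0%N w k 0| `^ (2 + eps))%:E).
      apply/measurable_EFinP.
      apply: (measurableT_comp (@measurable_powR R (2 + eps))).
      exact: (measurableT_comp (@measurable_realfun.normr_measurable R setT)).
    have m2 : measurable_fun setT
        (fun w => (stack_norm (fun i => v i 0%N w) `^ (2 + eps))%:E).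
      apply/measurable_EFinP.
      apply: (measurableT_comp (@measurable_powR R (2 + eps))).
      have -> : (fun w => stack_norm (fun i => v i 0%N w)) =
          (fun w => (\sum_i \sum_k v i 0%N w k 0 ^+ 2) `^ 2^-1).
        apply/funext => w; rewrite /stack_norm powR12_sqrt//.
        by do 2![apply: sumr_ge0 => ? _]; exact: sqr_ge0.
      apply: (measurableT_comp (@measurable_powR R 2^-1)).
      apply: measurable_sum => j; apply: measurable_sum => k'.
      exact: measurable_funX.
    apply: le_lt_trans (mom 0%N).
    apply: (@ge0_le_integral _ _ _ P setT measurableT _ _ _ m1 m2) => // w _.
    rewrite lee_fin ge0_ler_powR ?nnegrE ?sqrtr_ge0 ?(ltW p0)//.
    rewrite -sqrtr_sqr ler_sqrt; last first.
      by do 2![apply: sumr_ge0 => ? _]; exact: sqr_ge0.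
    rewrite (bigD1 i)//= (bigD1 k)//= -addrA lerDl addr_ge0//.
      by apply: sumr_ge0 => ? _; exact: sqr_ge0.
    by do 2![apply: sumr_ge0 => ? _]; exact: sqr_ge0.
have all_coord : {ae P, forall w, forall i k, \forall t \near \oo, `|v i t w k 0| <= pw kappa t}.
  by apply: filter_forall => i; apply: filter_forall => k; exact: coord.
apply: filterS all_coord => w Hw.
have : \forall t \near \oo, forall i k, `|v i t w k 0| <= pw kappa t.
  by apply: filter_forall => i; apply: filter_forall => k; exact: Hw.
apply: filterS => t Ht i; apply: le_trans (ler_enorm_l1 _) _.
apply: le_trans (_ : \sum_(k < m i) pw kappa t <= _); first exact: ler_sum.
rewrite sumr_const card_ord -[leLHS]mulr_natl ler_wpM2r ?pw_ge0//.
by rewrite (bigD1 i)//= lerDl sumr_ge0.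
Qed.

(** * Dynamics along a sample path *)

Section Dynamics.
Variables (R : realType) (N n : nat) (m : 'I_N -> nat) (H : forall i, 'M[R]_(m i, n)).
Variables (adj : rel 'I_N) (a b tau1 tau2 : R) (rho : 'I_N -> R) (rho0 : R).
Variables (theta : 'cV[R]_n) (nu : forall i : 'I_N, nat -> 'cV[R]_(m i)).
Variables (x0 : 'I_N -> 'cV[R]_n) (u0 : 'cV[R]_n).

Let alpha t := a / (t.+1%:R `^ tau1).
Let beta t := b / (t.+1%:R `^ tau2).
Let y i t := H i *m theta + nu i t.
Let X := est_x H adj alpha beta rho y x0.
Let Xh t := (est_state H adj alpha beta rho y x0 t).2.
Let u := central_u H alpha y u0.

Let innov t i x := (H i)^T *m (y i t - H i *m x).
(** [lag] is the total triggering error of the neighbours of [i]; [drive] gathers all of the update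
    except exact consensus. *)
Let lag t i := \sum_(j < N | adj i j) (Xh t j - X t j).
Let drive t i := alpha t *: innov t i (X t i) + beta t *: lag t i.
Let mean (f : 'I_N -> 'cV[R]_n) := N%:R^-1 *: \sum_i f i.
Let z t : 'I_N -> 'cV[R]_n := fun i => X t i - mean (X t).
Let d t := mean (X t) - u t.

(** [Xh t] is read after the triggering at time [t]: either the estimate was just sent, or the
    threshold was not exceeded. At [t = 0] the initial value was sent. *)
Lemma lag_threshold t i : enorm (Xh t i - X t i) <= pw (- rho i) t.
Proof.
rewrite /Xh /X /est_x; case: t => [|t] /=; first by rewrite subrr enorm0 pw_ge0.
case: est_state => xt xh /=; rewrite /trigger; case: ltP => [_|le_th].
  by rewrite subrr enorm0 pw_ge0.
by rewrite -enormN opprB pwN -div1r.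
Qed.

(** Replacing transmitted values by current ones yields an exact Laplacian step, at the price of
    [lag]. *)
Lemma estimator_step t i :
  X t.+1 i = X t i - beta t *: laplacian adj (X t) i + drive t i.
Proof.
have -> : X t.+1 i = X t i + alpha t *: innov t i (X t i)
    + beta t *: \sum_(j < N | adj i j) (Xh t j - X t i).
  by rewrite /X /Xh /est_x /=; case: est_state.
have -> : \sum_(j < N | adj i j) (Xh t j - X t i) = lag t i - laplacian adj (X t) i.
  rewrite /lag /laplacian -sumrB; apply: eq_bigr => j _.
  by rewrite opprB addrA subrK.
rewrite /drive; move: (X t i) (innov _ _ _) (lag t i) (laplacian _ _ _) => p q r v.
by apply/matrixP => k l; rewrite !mxE; ring.
Qed.

Hypotheses (N_gt0 : (0 < N)%N) (adj_sym : forall i j, adj i j = adj j i).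

Lemma sum_disagreement t : \sum_i z t i = 0.
Proof.
rewrite /z sumrB sumr_const card_ord /mean -scaler_nat scalerA divff ?scale1r ?subrr//.
by rewrite pnatr_eq0 -lt0n.
Qed.

Lemma mean_step t : mean (X t.+1) = mean (X t) + mean (drive t).
Proof.
rewrite /mean -scalerDr -big_split/=; congr (_ *: _).
rewrite (eq_bigr (fun i => (X t i + drive t i) - beta t *: laplacian adj (X t) i)).
  by rewrite sumrB -scaler_sumr (sum_laplacian adj_sym) scaler0 subr0.
by move=> i _; rewrite estimator_step addrAC.
Qed.

Lemma disagreement_step t : z t.+1 =
  (z t - beta t *: laplacian adj (z t)) + (fun i => drive t i - mean (drive t)).
Proof.
apply/funext => i; rewrite {1}/z estimator_step mean_step.
rewrite [RHS](_ : _ = (z t i - beta t *: laplacian adj (z t) i) + (drive t i - mean (drive t)))//.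
have -> : laplacian adj (z t) i = laplacian adj (X t) i.
  by apply: eq_bigr => j _; rewrite /z opprB addrA subrK.
rewrite /z.
move: (X t i) (mean (X t)) (laplacian _ _ _) (drive t i) (mean (drive t)) => p q r s v.
by apply/matrixP => k l; rewrite !mxE; ring.
Qed.

(** Obtained from [X = u + z + d]. The noise stays in the innovations at [u], which drive the
    centralized estimator and cancel in the recursion of [d]. *)
Lemma sum_innov t : \sum_i innov t i (X t i) =
  \sum_i innov t i (u t) - \sum_i (H i)^T *m (H i *m z t i) - gram H *m d t.
Proof.
rewrite /gram mulmx_suml -!sumrB; apply: eq_bigr => i _.
rewrite -mulmxA -!mulmxBr; congr (_ *m _).
have -> : X t i = u t + z t i + d t by rewrite /z /d addrC addrA subrK addrC subrK.
by rewrite !mulmxDr !opprD !addrA.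
Qed.

Lemma gap_step t : d t.+1 = (d t - (alpha t / N%:R) *: (gram H *m d t))
  + (- (alpha t / N%:R) *: (\sum_i (H i)^T *m (H i *m z t i))
     + (beta t / N%:R) *: \sum_i lag t i).
Proof.
rewrite {1}/d mean_step.
have -> : u t.+1 = u t + (alpha t / N%:R) *: \sum_i innov t i (u t) by [].
rewrite /mean /drive big_split/= -!scaler_sumr sum_innov -/(mean (X t)).
have -> : mean (X t) = d t + u t by rewrite /d subrK.
move: (d t) (u t) (\sum_i _) (\sum_i _) (\sum_i _) (gram H *m d t) => p q r s v w.
by apply/matrixP => k l; rewrite !mxE; ring.
Qed.

Lemma error_step t : u t.+1 - theta =
  (u t - theta) - (alpha t / N%:R) *: (gram H *m (u t - theta))
  + (alpha t / N%:R) *: \sum_i (H i)^T *m nu i t.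
Proof.
have -> : u t.+1 = u t + (alpha t / N%:R) *: \sum_i innov t i (u t) by [].
have -> : \sum_i innov t i (u t) =
    \sum_i (H i)^T *m nu i t - gram H *m (u t - theta).
  rewrite /gram mulmx_suml -sumrB; apply: eq_bigr => i _.
  rewrite -mulmxA -mulmxBr; congr (_ *m _).
  by rewrite /y mulmxBr opprB addrA [nu i t + _]addrC.
move: (\sum_i _) (gram H *m _) => p q.
by apply/matrixP => k l; rewrite !mxE; ring.
Qed.

Hypotheses (a_gt0 : 0 < a) (b_gt0 : 0 < b) (rho0_le : forall i, rho0 <= rho i).

(** A constant common to all agents; the added 1 pays for the noise entering beside [H i *m x]. *)
Let hb : R := \sum_i mxbound (H i)^T * (mxbound (H i) + 1).

Let alphaE t : alpha t = a * pw (- tau1) t. Proof. by rewrite pwN. Qed.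
Let betaE t : beta t = b * pw (- tau2) t. Proof. by rewrite pwN. Qed.
Let alpha_ge0 t : 0 <= alpha t. Proof. by rewrite alphaE mulr_ge0 ?pw_ge0// ltW. Qed.
Let beta_ge0 t : 0 <= beta t. Proof. by rewrite betaE mulr_ge0 ?pw_ge0// ltW. Qed.
Let N0 : 0 < N%:R :> R. Proof. by rewrite ltr0n. Qed.

Let alphaN_ge0 t : 0 <= alpha t / N%:R. Proof. exact: divr_ge0. Qed.
Let betaN_ge0 t : 0 <= beta t / N%:R. Proof. exact: divr_ge0. Qed.

Let hbi_ge0 i : 0 <= mxbound (H i)^T * (mxbound (H i) + 1).
Proof. by rewrite mulr_ge0 ?addr_ge0 ?mxbound_ge0. Qed.

Let hb_ge0 : 0 <= hb. Proof. exact: sumr_ge0. Qed.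

Let hb_gather i (x : 'cV[R]_n) (v : 'cV[R]_(m i)) e : enorm x + enorm v <= e ->
  enorm ((H i)^T *m (H i *m x + v)) <= hb * e.
Proof.
move=> xve; rewrite (le_trans (ler_enorm_mulmx _ _))//.
have le_hb : mxbound (H i)^T * (mxbound (H i) + 1) <= hb.
  by rewrite /hb (bigD1 i)//= lerDl sumr_ge0.
have e0 : 0 <= e by apply: le_trans xve; rewrite addr_ge0 ?enorm_ge0.
apply: le_trans (ler_wpM2r e0 le_hb); rewrite -mulrA ler_wpM2l ?mxbound_ge0//.
rewrite (le_trans (ler_enormD _ _))//.
have := ler_enorm_mulmx (H i) x.
have := ler_wpM2l (mxbound_ge0 (H i)) xve.
have := mulr_ge0 (mxbound_ge0 (H i)) (enorm_ge0 v).
have := enorm_ge0 x; lra.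
Qed.

Let lag_bound t i : enorm (lag t i) <= N%:R * pw (- rho0) t.
Proof.
apply: le_trans (ler_enorm_sum _ _ _) _; rewrite big_mkcond/=.
apply: le_trans (_ : \sum_(j < N) pw (- rho0) t <= _); last first.
  by rewrite sumr_const card_ord -[leLHS]mulr_natl.
apply: ler_sum => j _; case: ifP => _; last exact: pw_ge0.
by rewrite (le_trans (lag_threshold _ _))// ler_pw// lerN2.
Qed.

Let drive_bound t e : (forall i, enorm (theta - X t i) + enorm (nu i t) <= e) ->
  forall i, enorm (drive t i) <= alpha t * (hb * e) + beta t * (N%:R * pw (- rho0) t).
Proof.
move=> He i; rewrite (le_trans (ler_enormD _ _))// !enormZ !ger0_norm//.
rewrite lerD// ler_wpM2l// /innov /y addrAC -mulmxBr.
exact: hb_gather (He i).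
Qed.

Let mean_bound (f : 'I_N -> 'cV[R]_n) e : (forall i, enorm (f i) <= e) ->
  enorm (mean f) <= e.
Proof.
move=> He; rewrite /mean enormZ ger0_norm ?invr_ge0 ?(ltW N0)// ler_pdivrMl//.
rewrite (le_trans (ler_enorm_sum _ _ _))//.
rewrite mulr_natl -[X in _ *+ X]card_ord -sumr_const.
exact: ler_sum.
Qed.

Variables (Cnu kappa : R).
Hypotheses (Cnu_ge0 : 0 <= Cnu) (kappa_ge0 : 0 <= kappa).
Hypothesis nu_growth : \forall t \near \oo, forall i, enorm (nu i t) <= Cnu * pw kappa t.
Variables (l : R).
Hypotheses (l_gt0 : 0 < l) (tau1_gt0 : 0 < tau1) (tau2_gt0 : 0 < tau2).
Hypothesis gram_coercive : forall x, l * cdot x x <= cdot x (gram H *m x).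

(** A gradient step of length [alpha / N]: as [alpha] tends to 0 its quadratic term becomes
    negligible, so any rate below [l / N] is eventually reached. *)
Let gram_contraction mu : mu < l / N%:R -> \forall t \near \oo, forall x,
  enorm (x - (alpha t / N%:R) *: (gram H *m x)) <= (1 - mu * alpha t) * enorm x.
Proof.
move=> mul; pose K := mxbound (gram H) ^+ 2.
have gap : 0 < (l - mu * N%:R) *+ 2.
  by rewrite pmulrn_lgt0// subr_gt0 -ltr_pdivlMr.
have t1 : - tau1 < 0 by rewrite oppr_lt0.
apply: filterS2 (pw_near_le (a / N%:R * (mu * N%:R)) t1 ltr01)
  (pw_near_le (a / N%:R * K) t1 gap) => t H1 H2 x.
rewrite !enormE.
have -> : mu * alpha t = alpha t / N%:R * (mu * N%:R).
  by field; rewrite gt_eqF.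
apply: (dnorm_gradient_step (@cdotC R n) (@cdotDl R n) (@cdotZl R n) (@cdot_ge0 R n)
  (K := K) (gram_coercive x)).
- rewrite -!enorm_sq -exprMn ler_sqr ?nnegrE ?mulr_ge0 ?enorm_ge0 ?mxbound_ge0//.
  exact: ler_enorm_mulmx.
- exact: alphaN_ge0.
- by apply: le_trans H1; rewrite alphaE le_eqVlt; apply/orP; left; apply/eqP; ring.
- by apply: le_trans H2; rewrite alphaE le_eqVlt; apply/orP; left; apply/eqP; ring.
Qed.

(** Half of the coercivity constant is the rate; the other half absorbs the quadratic term once
    [beta] is small. *)
Let laplacian_contraction : (forall i j, connect adj i j) ->
  exists2 c, 0 < c & \forall t \near \oo, forall f : 'I_N -> 'cV[R]_n, \sum_i f i = 0 ->
    snorm (f - beta t *: laplacian adj f) <= (1 - c * beta t) * snorm f.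
Proof.
move=> adj_conn; have [c c0 Hc] := @laplacian_coercive R N n _ adj_sym adj_conn N_gt0.
have [K K0 HK] := @laplacian_bound R N n adj.
exists (c / 2); first by rewrite divr_gt0.
have gap : 0 < (c - c / 2) *+ 2 by rewrite pmulrn_lgt0//; lra.
have t2 : - tau2 < 0 by rewrite oppr_lt0.
apply: filterS2 (pw_near_le (b * (c / 2)) t2 ltr01) (pw_near_le (b * K) t2 gap)
  => t H1 H2 f f0; rewrite [c / 2 * _]mulrC.
apply: (dnorm_gradient_step (@sdotC R N n) (@sdotDl R N n) (@sdotZl R N n) (@sdot_ge0 R N n)
  (K := K) (Hc f f0) (HK f)) => //.
- by apply: le_trans H1; rewrite betaE le_eqVlt; apply/orP; left; apply/eqP; ring.
- by apply: le_trans H2; rewrite betaE le_eqVlt; apply/orP; left; apply/eqP; ring.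
Qed.

(* A noise bound [(t+1)^kappa] only yields the same growth for the error of the
   centralized estimator, but this is all that is needed: the drive of the
   disagreement is then of order [alpha (t+1)^kappa]. *)
Let error_growth : exists2 W, 0 <= W &
  \forall t \near \oo, enorm (u t - theta) <= W * pw kappa t.
Proof.
have lN : 0 < l / N%:R by rewrite divr_gt0.
apply: (@linear_growth R _ (l / N%:R / 2) (hb * Cnu) a tau1) => //.
- by rewrite divr_gt0.
- by rewrite mulr_ge0.
have half : l / N%:R / 2 < l / N%:R by lra.
apply: filterS2 (gram_contraction half) nu_growth => t H1 H2.
rewrite error_step (le_trans (ler_enormD _ _))// -alphaE lerD//.
rewrite enormZ ger0_norm//.
rewrite [leRHS](_ : _ = alpha t / N%:R * (N%:R * (hb * (Cnu * pw kappa t)))); last first.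
  by field; rewrite gt_eqF.
apply: ler_wpM2l => //.
apply: le_trans (ler_enorm_sum _ _ _) _.
rewrite mulr_natl -[X in _ *+ X]card_ord -sumr_const; apply: ler_sum => i _.
have := @hb_gather i 0 (nu i t) (Cnu * pw kappa t).
by rewrite mulmx0 add0r enorm0 add0r; apply.
Qed.

(** The norms of [z] and [d] satisfy the system of [coupled_decay], and [X i - u = z i + d]. *)
Lemma pathwise_tracking tau0 : (forall i j, connect adj i j) ->
  0 <= tau0 -> tau1 <= 1 -> tau2 < tau1 ->
  tau0 + kappa < tau1 - tau2 -> tau0 < rho0 + tau2 - tau1 ->
  (tau1 = 1 -> N%:R * tau0 / l < a) ->
  forall i, pw tau0 t * enorm (X t i - u t) @[t --> \oo] --> (0 : R).
Proof.
move=> adj_conn tau00 tau11 tau21 Hk Hrho Hl i.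
have [c c0 Hc] := laplacian_contraction adj_conn.
have [W W0 HW] := error_growth.
(* For [tau1 = 1] the step-size condition says [tau0 / a < l / N], and the midpoint serves;
   otherwise half of [l / N] does. *)
have [mu [mu0 mul Hmu]] : exists mu, [/\ 0 < mu, mu < l / N%:R & tau1 = 1 -> tau0 < a * mu].
  have lN : 0 < l / N%:R by rewrite divr_gt0.
  have ta0 : 0 <= tau0 / a by rewrite divr_ge0// ltW.
  have [t1|t1] := eqVneq tau1 1; last first.
    by exists (l / N%:R / 2); split; [lra|lra|move=> t1'; rewrite t1' eqxx in t1].
  have : tau0 / a < l / N%:R.
    rewrite ltr_pdivrMr// mulrAC ltr_pdivlMr// mulrC [l * a]mulrC -ltr_pdivrMr//.
    exact: Hl.
  exists ((tau0 / a + l / N%:R) / 2); split; [lra|lra|move=> _].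
  by rewrite mulrC -ltr_pdivrMr//; lra.
(* [2 N] comes from removing the mean and stacking, [1 + W + Cnu] from the innovations, the last [N]
   from the number of neighbours. *)
pose C := N%:R * 2 * (hb * (1 + W + Cnu) + N%:R).
have C0 : 0 <= C by rewrite !(mulr_ge0, addr_ge0).
have [hbC NC] : hb <= C /\ N%:R <= C.
  have WC0 : 0 <= hb * (W + Cnu) by rewrite mulr_ge0// addr_ge0.
  pose D := hb * (1 + W + Cnu) + N%:R.
  have DE : D = hb + hb * (W + Cnu) + N%:R by rewrite /D; ring.
  have D0 : 0 <= D by rewrite DE !addr_ge0.
  have DC : D <= C.
    by rewrite /C -/D ler_peMl// -natrM ler1n muln_gt0 N_gt0.
  split; apply: le_trans DC; rewrite DE; first by rewrite -addrA lerDl addr_ge0.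
  by rewrite lerDr addr_ge0.
have lim := @coupled_decay R (fun t => snorm (z t)) (fun t => enorm (d t))
  a b c C mu tau0 tau1 tau2 kappa rho0.
have {}lim := lim (fun t => snorm_ge0 _) (fun t => enorm_ge0 _).
have {}lim : pw tau0 t * (snorm (z t) + enorm (d t)) @[t --> \oo] --> (0 : R).
  apply: lim => //.
  - apply: filterS3 Hc HW nu_growth => t H1 H2 H3.
    rewrite -alphaE -betaE disagreement_step (le_trans (ler_snormD _ _))//.
    rewrite -2![leRHS]addrA lerD//; first by apply: H1; exact: sum_disagreement.
    (* Bounds estimation error plus noise, through [X - theta = z + d + (u - theta)]. *)
    set e := snorm (z t) + enorm (d t) + (W + Cnu) * pw kappa t.
    have He j : enorm (theta - X t j) + enorm (nu j t) <= e.
      rewrite -enormN opprB.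
      have -> : X t j - theta = z t j + d t + (u t - theta).
        by rewrite /z /d [_ + (mean _ - _)]addrA subrK addrA subrK.
      have := ler_enormD (z t j + d t) (u t - theta).
      have := ler_enormD (z t j) (d t).
      have := ler_enorm_snorm (z t) j; have := H3 j.
      rewrite /e; lra.
    have Hd := drive_bound He.
    set B := _ + _ in Hd.
    have B0 : 0 <= B := le_trans (enorm_ge0 _) (Hd i).
    apply: le_trans (_ : N%:R * (2 * B) <= _).
      apply: ler_snorm_sup => [|j]; first by rewrite mulr_ge0.
      rewrite (le_trans (ler_enormD _ _))// enormN mulr_natl mulr2n lerD//.
      exact: mean_bound.
    have S0 := snorm_ge0 (z t); have D0 := enorm_ge0 (d t).
    have K0 := pw_ge0 kappa t; have R0 := pw_ge0 (- rho0) t.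
    have A0 := alpha_ge0 t; have Be0 := beta_ge0 t.
    rewrite /B /e /C; move: S0 D0 K0 R0 A0 Be0.
    move: (snorm (z t)) (enorm (d t)) (pw kappa t) (pw (- rho0) t) (alpha t) (beta t).
    move=> S D K Rh A Be S0 D0 K0 R0 A0 Be0.
    (* The slack is a polynomial with nonnegative coefficients in nonnegative quantities. *)
    rewrite -subr_ge0.
    rewrite [leRHS](_ : _ = N%:R * 2 * (A * (hb * (W + Cnu) + N%:R) * (S + D)
      + A * (hb + N%:R) * K + Be * (hb * (1 + W + Cnu)) * Rh)); last by ring.
    by rewrite !(mulr_ge0, addr_ge0).
  - apply: filterS (gram_contraction mul) => t H1.
    rewrite -alphaE -betaE gap_step (le_trans (ler_enormD _ _))// -[leRHS]addrA lerD//.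
    rewrite (le_trans (ler_enormD _ _))// lerD// enormZ.
      rewrite normrN ger0_norm//.
      have Hs : enorm (\sum_i (H i)^T *m (H i *m z t i)) <= N%:R * (hb * snorm (z t)).
        rewrite (le_trans (ler_enorm_sum _ _ _))//.
        rewrite mulr_natl -[X in _ *+ X]card_ord -sumr_const; apply: ler_sum => j _.
        have := @hb_gather j (z t j) 0 (snorm (z t)).
        by rewrite enorm0 !addr0; apply; exact: ler_enorm_snorm.
      apply: le_trans (ler_wpM2l _ Hs) _ => //.
      rewrite [leLHS](_ : _ = hb * (alpha t * snorm (z t))); last first.
        by field; rewrite gt_eqF.
      by rewrite -[leRHS]mulrA ler_wpM2r// mulr_ge0// snorm_ge0.
    rewrite ger0_norm//.
    have Hs : enorm (\sum_i lag t i) <= N%:R * (N%:R * pw (- rho0) t).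
      rewrite (le_trans (ler_enorm_sum _ _ _))//.
      by rewrite mulr_natl -[X in _ *+ X]card_ord -sumr_const; apply: ler_sum.
    apply: le_trans (ler_wpM2l _ Hs) _ => //.
    rewrite [leLHS](_ : _ = N%:R * (beta t * pw (- rho0) t)); last first.
      by field; rewrite gt_eqF.
    by rewrite -[leRHS]mulrA ler_wpM2r// mulr_ge0// pw_ge0.
apply: (squeeze_cvgr _ (cvg_cst _) lim); apply: nearW => t.
rewrite mulr_ge0 ?pw_ge0 ?enorm_ge0//= ler_wpM2l ?pw_ge0//.
have -> : X t i - u t = z t i + d t by rewrite /z /d addrA subrK.
by rewrite (le_trans (ler_enormD _ _))// lerD2r ler_enorm_snorm.
Qed.

End Dynamics.

(** * From single sample paths to almost sure convergence *)

Theorem theorem4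
  (R : realType) (d : measure_display) (T : measurableType d)
  (P : probability T R)
  (N n : nat) (m : 'I_N -> nat)
  (H : forall i : 'I_N, 'M[R]_(m i, n))
  (theta : 'cV[R]_n)
  (v : forall i : 'I_N, nat -> T -> 'cV[R]_(m i))
  (adj : rel 'I_N)
  (rho : 'I_N -> R) (rho0 : R)
  (a b tau1 tau2 ac tauc eps1 tau0 : R)
  (x0 : 'I_N -> 'cV[R]_n) (u0 : 'cV[R]_n) :
  (* noise: i.i.d. over time, zero mean, (2+eps1)-th moment *)
  noise_iid P v ->
  noise_zero_mean P v ->
  0 < eps1 ->
  noise_moment P v eps1 ->
  (* communication graph *)
  undirected_simple adj ->
  connected_graph adj ->
  (* G full rank *)
  \rank (gram H) = n ->
  (* thresholds *)
  (forall i, 0 < rho i) ->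
  is_min_of rho rho0 ->
  rho0 > tau1 - tau2 ->
  (* step sizes *)
  0 < a -> 0 < b ->
  0 < tau2 -> tau2 <= tau1 -> tau1 <= 1 ->
  tau1 > Num.max (tau2 + 1 / (2 + eps1)) (1 / 2) ->
  tauc = tau1 -> ac = a ->
  (* tau0 *)
  0 <= tau0 ->
  tau0 < Num.min (tau1 - tau2 - 1 / (2 + eps1)) (rho0 + tau2 - tau1) ->
  (tau1 = 1 -> forall lmin, is_min_eigenvalue (gram H) lmin ->
      a > N%:R * tau0 / lmin) ->
  let alpha := fun t : nat => a / (t.+1%:R `^ tau1) in
  let beta := fun t : nat => b / (t.+1%:R `^ tau2) in
  let alphac := fun t : nat => ac / (t.+1%:R `^ tauc) in
  let y := fun w (i : 'I_N) (t : nat) => H i *m theta + v i t w in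
  forall i : 'I_N,
    {ae P, forall w,
      (fun t : nat => t.+1%:R `^ tau0 *
         enorm (est_x H adj alpha beta rho (y w) x0 t i
                - central_u H alphac (y w) u0 t))
      @ \oo --> (0 : R)}.
Proof.
move=> [mv [_ idv]] _ eps0 mom [adj_sym _] adj_conn rk _ [[j0 _] rho0_le] Hrho a0 b0
  tau20 tau21 tau11 Htau1 -> -> tau00 Htau0 Hl alpha beta alphac y i.
(* The minimum [rho0] is attained at some agent, so there is one. *)
have N0 : (0 < N)%N by case: (N) j0 => // -[].
have ie0 : 0 < 1 / (2 + eps1) by rewrite divr_gt0// addr_gt0.
move: Htau1 Htau0; rewrite gt_max lt_min => /andP[Ht1 _] /andP[Ht0 Ht0'].
(* The midpoint of the interval between [1 / (2 + eps1)] and [tau1 - tau2 - tau0], nonempty by the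
   bound on [tau0]. *)
pose kappa := (1 / (2 + eps1) + (tau1 - tau2 - tau0)) / 2.
have kap : 1 / (2 + eps1) < kappa by rewrite /kappa; lra.
have kap' : tau0 + kappa < tau1 - tau2 by rewrite /kappa; lra.
have [l [l0 Ql Hll]] : exists l, [/\ 0 < l, tau1 = 1 -> N%:R * tau0 / l < a &
    forall x, l * cdot x x <= cdot x (gram H *m x)].
  apply: gram_rayleigh_bound rk _ _; last by move=> l min_l t1; exact: Hl.
  (* The default value for [n = 0], chosen so that [N tau0 / l < a]. *)
  have Nt : 0 <= N%:R * tau0 / a by rewrite mulr_ge0 ?invr_ge0 ?mulr_ge0// ltW.
  exists (N%:R * tau0 / a + 1) => [|_]; first by rewrite ltr_wpDl.
  by rewrite ltr_pdivrMr ?ltr_wpDl// mulrDr mulrCA divff ?gt_eqF// !mulr1 ltrDl.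
apply: filterS (noise_growth mv idv eps0 mom kap) => w Hw.
apply: (pathwise_tracking theta (nu := fun i t => v i t w) x0 u0 N0 adj_sym a0 b0 rho0_le
  _ _ Hw l0) => //; [exact: sumr_ge0|lra..].
Qed.
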